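(* Assume the reduced operator $\widehat A_h\in\mathbb{R}^{M_h\times n_h}$ has full column rank with $M_h\ge n_h$. Then $$U_\theta-U_h^\star=Z_h\widehat H_h^{-1}\widehat A_h^\top W_hr_h .$$
   Context: Let $U_{0,h}\in\mathbb{R}^{N_h}$ and let $Z_h\in\mathbb{R}^{N_h\times n_h}$ have full column rank. Let $A_h\in\mathbb{R}^{M_h\times N_h}$, $b_h\in\mathbb{R}^{M_h}$, $\widehat A_h:=A_hZ_h$, $\widehat b_h:=b_h-A_hU_{0,h}$. Let $W_h\in\mathbb{R}^{M_h\times M_h}$ be symmetric positive definite, $\|r\|_{W_h}:=(r^\top W_hr)^{1/2}$, $\widehat H_h:=\widehat A_h^\top W_h\widehat A_h$. The discrete target is the least-squares solution $y_h^\star:=\arg\min_{y\in\mathbb{R}^{n_h}}\frac12\|\widehat A_hy-\widehat b_h\|_{W_h}^2$, $U_h^\star:=U_{0,h}+Z_hy_h^\star$. $U_\theta=U_{0,h}+Z_hy_\theta$ (with $y_\theta\in\mathbb{R}^{n_h}$) is an arbitrary admissible vector with residual $r_h:=A_hU_\theta-b_h=\widehat A_hy_\theta-\widehat b_h$. *)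

(* Defs.v *)
From HB Require Import structures.
From mathcomp Require Import all_boot all_order all_algebra.
From mathcomp Require Import all_classical reals.

Set Implicit Arguments.
Unset Strict Implicit.
Unset Printing Implicit Defensive.

Import Order.TTheory GRing.Theory Num.Theory.

Local Open Scope classical_set_scope.
Local Open Scope ring_scope.

Definition full_col_rank (R : realType) (m n : nat) (B : 'M[R]_(m, n)) : Prop :=
  \rank B = n.

Definition spd (R : realType) (m : nat) (W : 'M[R]_m) : Prop :=
  W^T = W /\ forall x : 'cV[R]_m, x != 0 -> 0 < (x^T *m W *m x) 0 0.

Definition wnorm (R : realType) (m : nat) (W : 'M[R]_m) (r : 'cV[R]_m) : R :=
  Num.sqrt ((r^T *m W *m r) 0 0).

Definition minimizers (R : realType) (n : nat) (J : 'cV[R]_n -> R) :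
    set 'cV[R]_n :=
  [set y | forall z, J y <= J z].

(* Definite description: the value is the unique minimizer of J when there is
   exactly one, and the default 0 when there is none or more than one. *)
Definition argmin (R : realType) (n : nat) (J : 'cV[R]_n -> R) : 'cV[R]_n :=
  xget 0 [set y | minimizers J = [set y]].

Definition least_squares (R : realType) (m n : nat) (W : 'M[R]_m)
    (B : 'M[R]_(m, n)) (c : 'cV[R]_m) : 'cV[R]_n :=
  argmin (fun y => 2^-1 * wnorm W (B *m y - c) ^+ 2).

(* Main.v *)
Require Import Defs.
From HB Require Import structures.
From mathcomp Require Import all_boot all_order all_algebra.
From mathcomp Require Import all_classical reals.

Set Implicit Arguments.
Unset Strict Implicit.
Unset Printing Implicit Defensive.

Import Order.TTheory GRing.Theory Num.Theory.

Local Open Scope ring_scope.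

(** Since the gradient [B^T W (B y - c)] vanishes at [y0 = H^-1 B^T W c], where
    [H = B^T W B], the objective splits by Pythagoras as
    [|B z - c|_W^2 = |B y0 - c|_W^2 + (z - y0)^T H (z - y0)]. As [H] is positive
    definite, [y0] is the unique minimizer, and applying [H^-1 B^T W] to the
    residual [B y - c] gives back the error [y - y0]. *)

(** Row freeness in the library concerns multiplication on the left, so the argument passes to
    [B^T]. *)
Lemma full_col_rank_inj (R : realType) (m n : nat) (B : 'M[R]_(m, n))
    (v : 'cV[R]_n) :
  full_col_rank B -> B *m v = 0 -> v = 0.
Proof.
move=> rB Bv0; have fB : row_free B^T by rewrite /row_free mxrank_tr rB.
by apply: trmx_inj; apply: (row_free_inj fB);
  rewrite -trmx_mul Bv0 !trmx0 mul0mx.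
Qed.

Lemma spd_ge0 (R : realType) (m : nat) (W : 'M[R]_m) (x : 'cV[R]_m) :
  spd W -> 0 <= (x^T *m W *m x) 0 0.
Proof.
case=> _ Wpos; have [->|/Wpos/ltW//] := eqVneq x 0.
by rewrite mulmx0 mxE.
Qed.

(** A nonzero row [v] with [v W = 0] would make the quadratic form vanish at [v^T], against
    positivity. *)
Lemma spd_unitmx (R : realType) (m : nat) (W : 'M[R]_m) :
  spd W -> W \in unitmx.
Proof.
case=> _ Wpos; rewrite -row_free_unit; apply: inj_row_free => v vW0.
apply/eqP; apply: contraT; rewrite -trmx_eq0 => /Wpos.
by rewrite trmxK vW0 mul0mx mxE ltxx.
Qed.

Lemma spd_congr (R : realType) (m n : nat) (W : 'M[R]_m) (B : 'M[R]_(m, n)) :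
  spd W -> full_col_rank B -> spd (B^T *m W *m B).
Proof.
case=> Wsym Wpos rB; split=> [|x x0].
  by rewrite !trmx_mul trmxK Wsym mulmxA.
have Bx0 : B *m x != 0 by apply: contra_neq x0; apply: full_col_rank_inj.
by have := Wpos _ Bx0; rewrite trmx_mul !mulmxA.
Qed.

Lemma wnorm_sqr (R : realType) (m : nat) (W : 'M[R]_m) (r : 'cV[R]_m) :
  spd W -> wnorm W r ^+ 2 = (r^T *m W *m r) 0 0.
Proof. by move=> Wspd; rewrite /wnorm sqr_sqrtr// spd_ge0. Qed.

Lemma wnorm_sqrD_orth (R : realType) (m : nat) (W : 'M[R]_m) (u v : 'cV[R]_m) :
  spd W -> u^T *m W *m v = 0 ->
  wnorm W (u + v) ^+ 2 = wnorm W u ^+ 2 + wnorm W v ^+ 2.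
Proof.
(* By symmetry of [W], the second cross term is the transpose of the first. *)
move=> Wspd uv0; have vu0 : v^T *m W *m u = 0.
  apply: trmx_inj; rewrite !trmx_mul trmxK trmx0.
  by case: (Wspd) => -> _; rewrite mulmxA.
rewrite !wnorm_sqr// [(u + v)^T]linearD /= !mulmxDl !mulmxDr uv0 vu0 addr0 add0r.
by rewrite mxE.
Qed.

(** The strict inequality makes the set of minimizers a singleton, which rules out the default value
    of [argmin]. *)
Lemma argmin_unique (R : realType) (n : nat) (J : 'cV[R]_n -> R) (y : 'cV[R]_n) :
  (forall z, z != y -> J y < J z) -> argmin J = y.
Proof.
move=> Jlt; have minJ : minimizers J = [set y]%classic.
  apply/seteqP; split=> z /=.
    move=> zmin; apply/eqP; apply: contraT => /Jlt.
    by rewrite ltNge zmin.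
  move=> -> t; have [->//|/Jlt/ltW//] := eqVneq t y.
rewrite /argmin; case: xgetP => [z _ /= zmin|/(_ y)/(_ minJ)//].
by have : minimizers J z; [rewrite zmin | rewrite minJ].
Qed.

Lemma least_squaresE (R : realType) (m n : nat) (W : 'M[R]_m)
    (B : 'M[R]_(m, n)) (c : 'cV[R]_m) :
  spd W -> full_col_rank B ->
  least_squares W B c = invmx (B^T *m W *m B) *m B^T *m W *m c.
Proof.
move=> Wspd rB; have Hspd := spd_congr Wspd rB.
have Hunit := spd_unitmx Hspd.
set H := B^T *m W *m B in Hspd Hunit *.
set y := invmx H *m B^T *m W *m c.
have normal_eq : B^T *m W *m (B *m y - c) = 0.
  by rewrite mulmxBr mulmxA -/H /y !mulmxA mulmxV// mul1mx subrr.
(* From here on, the normal equation is all that is needed about [y]. *)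
clearbody y; apply: argmin_unique => z zy.
(* Transposed, this is the normal equation multiplied on the left by [(z - y)^T]. *)
have orth : (B *m y - c)^T *m W *m (B *m (z - y)) = 0.
  apply: trmx_inj; rewrite trmx0 trmx_mul [(_ *m W)^T]trmx_mul trmxK.
  rewrite [(B *m _)^T]trmx_mul.
  by case: (Wspd) => -> _; rewrite -mulmxA (mulmxA B^T) normal_eq mulmx0.
have -> : B *m z - c = (B *m y - c) + B *m (z - y).
  by rewrite mulmxBr [RHS]addrC addrA subrK.
rewrite (wnorm_sqrD_orth Wspd orth).
rewrite mulrDr ltrDl mulr_gt0 ?invr_gt0 ?ltr0n// wnorm_sqr//.
have := Hspd.2 (z - y); rewrite subr_eq0 => /(_ zy).
by rewrite /H trmx_mul !mulmxA.
Qed.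

Lemma least_squares_error (R : realType) (m n : nat) (W : 'M[R]_m)
    (B : 'M[R]_(m, n)) (c : 'cV[R]_m) (y : 'cV[R]_n) :
  spd W -> full_col_rank B ->
  y - least_squares W B c =
    invmx (B^T *m W *m B) *m B^T *m W *m (B *m y - c).
Proof.
move=> Wspd rB; rewrite least_squaresE// mulmxBr; congr (_ - _).
have Hunit := spd_unitmx (spd_congr Wspd rB).
(* Here [y] is written as [H^-1 (H y)], with [H = B^T W B]. *)
by rewrite -[LHS](mulKmx Hunit) !mulmxA.
Qed.

Theorem propositionB3 (R : realType) (N n M : nat)
    (U0 : 'cV[R]_N) (Z : 'M[R]_(N, n)) (A : 'M[R]_(M, N)) (b : 'cV[R]_M)
    (W : 'M[R]_M) (ytheta : 'cV[R]_n) :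
  let Ahat := A *m Z in
  let bhat := b - A *m U0 in
  let Hhat := Ahat^T *m W *m Ahat in
  let ystar := least_squares W Ahat bhat in
  let Ustar := U0 + Z *m ystar in
  let Utheta := U0 + Z *m ytheta in
  let r := A *m Utheta - b in
  full_col_rank Z ->
  spd W ->
  (n <= M)%N ->
  full_col_rank Ahat ->
  Utheta - Ustar = Z *m invmx Hhat *m Ahat^T *m W *m r.
Proof.
move=> Ahat bhat Hhat ystar Ustar Utheta r _ Wspd _ rA.
(* The offset [A U0] moves into [bhat], so the full residual is the residual of the reduced
   problem. *)
have -> : r = Ahat *m ytheta - bhat.
  by rewrite /r /Utheta /Ahat /bhat mulmxDr mulmxA opprB addrCA addrA.
rewrite /Utheta /Ustar opprD addrACA subrr add0r -mulmxBr.
by rewrite least_squares_error// 3!(mulmxA Z).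
Qed.
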